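(* Let $p\ge1$ be an integer, $\mu>0$ real, and $\mathbf A,\mathbf B,\mathbf C\in M(p,\mathbb C)$ with $\mathbf A=\mathbf A^\dagger$, $\mathbf C=\mathbf C^\dagger$. Consider the differential equation for $\mathbb C^p$-valued functions $f(z)$ $$(\mathbf Bz^2+\mathbf Az+\mathbf B^\dagger)\frac{df}{dz}=\Bigl(-\mu\mathbf Bz-\frac\mu2\mathbf A+\mathbf C\Bigr)f.\qquad( * )$$ Suppose that $\det(\mathbf Bz^2+\mathbf Az+\mathbf B^\dagger)$ is not identically zero and that all poles of $(\mathbf Bz^2+\mathbf Az+\mathbf B^\dagger)^{-1}$ are of order $1$, and consider the partial fraction decomposition $$(\mathbf Bz^2+\mathbf Az+\mathbf B^\dagger)^{-1}=\sum_{j=1}^N\frac1{z-\alpha_j}\mathbf P_{\alpha_j}+\sum_{k=0}^M\mathbf Q_kz^k,$$ where $\alpha_j\in\mathbb C$ are distinct, $\mathbf P_{\alpha_j},\mathbf Q_k\in M(p,\mathbb C)$, and $\mathbf P_{\alpha_j}\ne\mathbf 0$. 1. The equation $( * )$ is equal to the Fuchsian equation $$\frac{df}{dz}=\sum_{j=1}^N\frac1{z-\alpha_j}\mathbf P_{\alpha_j}\Bigl(-\mu\Bigl(\alpha_j\mathbf B+\frac12\mathbf A\Bigr)+\mathbf C\Bigr)f.$$ 2. If $( * )$ is singular at $z=\alpha$ $(\ne0,\infty)$, then it is also singular at $z=\overline\alpha^{-1}$. 3. We have $$-\sum_{j=1}^N\mathbf P_{\alpha_j}\Bigl(-\mu\Bigl(\alpha_j\mathbf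 B+\frac12\mathbf A\Bigr)+\mathbf C\Bigr)=\begin{cases}\mu\mathbf I&(\det(\mathbf B)\ne0),\\ \mu\mathbf I-\mathbf P_0^\dagger\bigl(\frac\mu2\mathbf A+\mathbf C\bigr)&(\det(\mathbf B)=0).\end{cases}$$ 4. We have $\operatorname{rank}\bigl(\mathbf P_{\alpha_j}\bigl(-\mu\bigl(\alpha_j\mathbf B+\frac12\mathbf A\bigr)+\mathbf C\bigr)\bigr)\le\dim\operatorname{Ker}(\alpha_j^2\mathbf B+\alpha_j\mathbf A+\mathbf B^\dagger)$. That is, $\mathbf P_{\alpha_j}\bigl(-\mu\bigl(\alpha_j\mathbf B+\frac12\mathbf A\bigr)+\mathbf C\bigr)$ has an eigenvalue $0$ with multiplicity at least $p-\dim\operatorname{Ker}(\alpha_j^2\mathbf B+\alpha_j\mathbf A+\mathbf B^\dagger)$. 5. For $u\in\operatorname{Im}\mathbf P_{\alpha_j}\subset\mathbb C^p$, we have $$\mathbf P_{\alpha_j}\Bigl(-\mu\Bigl(\alpha_j\mathbf B+\frac12\mathbf A\Bigr)+\mathbf C\Bigr)u=\mathbf P_{\alpha_j}\mathbf Cu-\frac\mu2u.$$ That is, non-zero eigenvalues of $\mathbf P_{\alpha_j}\bigl(-\mu\bigl(\alpha_j\mathbf B+\frac12\mathbf A\bigr)+\mathbf C\bigr)$ are equal to $-\frac\mu2$ plus those of $\mathbf P_{\alpha_j}\mathbf C$.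
   Context: $\mathbf X^\dagger$ denotes the conjugate transpose of a matrix $\mathbf X$, $\mathbf I$ the identity matrix, $\mathbf 0$ the zero matrix, and $\operatorname{Im}\mathbf P_{\alpha_j}$ the image of $\mathbf P_{\alpha_j}$. In item 3, when $\det(\mathbf B)=0$, $\mathbf P_0$ is the coefficient matrix in the partial fraction decomposition at the pole $0$. *)

(* Defs.v *)
From HB Require Import structures.
From mathcomp Require Import all_boot all_order all_algebra.
From mathcomp Require Import all_classical all_reals all_analysis.
From mathcomp Require Export complex.

Set Implicit Arguments.
Unset Strict Implicit.
Unset Printing Implicit Defensive.

Import Order.TTheory GRing.Theory Num.Theory.
Import numFieldNormedType.Exports.
Local Open Scope classical_set_scope.
Local Open Scope ring_scope.
Local Open Scope sesquilinear_scope.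

Section Pencil.
Variables (K : numClosedFieldType) (p : nat).
Implicit Types (A B C P : 'M[K]_p) (mu z a : K) (f : K -> 'cV[K]_p).

(* B z^2 + A z + B^dagger; [M ^t*] is the conjugate transpose. *)
Definition pencil A B z : 'M[K]_p := z ^+ 2 *: B + z *: A + B ^t*.

(* (z - a) (pencil z)^-1 has a limit at every a. The junk value of [invmx] at
   singular matrices is irrelevant as soon as \det (pencil z) is not
   identically zero, its zeros being then isolated. *)
Definition simple_poles A B : Prop :=
  forall a, cvg ((fun z => (z - a) *: invmx (pencil A B z)) @ a^').

Definition partial_fractions A B (N : nat) (alpha : 'I_N -> K)
    (P : 'I_N -> 'M[K]_p) (M : nat) (Q : 'I_M.+1 -> 'M[K]_p) : Prop :=
  forall z, \det (pencil A B z) != 0 -> (forall j, z != alpha j) ->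
    invmx (pencil A B z) =
      \sum_(j < N) (z - alpha j)^-1 *: P j + \sum_(k < M.+1) z ^+ k *: Q k.

(* Both predicates below say that the equation holds at each point of U, with
   f complex differentiable there; U is an open set in the usual situation. *)
Definition solves_pencil_ode mu A B C (U : set K) f : Prop :=
  forall z, U z -> derivable f z 1 /\
    pencil A B z *m derive1 f z = (- (mu * z) *: B - (mu / 2) *: A + C) *m f z.

Definition solves_fuchsian (N : nat) (alpha : 'I_N -> K)
    (S : 'I_N -> 'M[K]_p) (U : set K) f : Prop :=
  forall z, U z -> derivable f z 1 /\
    derive1 f z = (\sum_(j < N) (z - alpha j)^-1 *: S j) *m f z.

(* Singular point of the equation: its leading coefficient degenerates. This
   does not ask that the residue below be nonzero: the residue may vanish at
   such a point a and not at a^*^-1 (already for p = 1). *)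
Definition singular_at A B a : Prop := \det (pencil A B a) = 0.

Definition residue mu A B C P a : 'M[K]_p :=
  P *m (- (mu *: (a *: B + 2^-1 *: A)) + C).

(* Matrices act on column vectors whereas [kermx] is the kernel of the action
   on row vectors, hence the transpose. *)
Definition dimker (X : 'M[K]_p) : nat := \rank (kermx X^T).

Definition im_mx (X : 'M[K]_p) : set 'cV[K]_p := [set X *m v | v in [set: 'cV[K]_p]].

End Pencil.

(* Main.v *)
(* Write L for the pencil. Away from the alpha_j, L is invertible, and
   L(alpha_j) P_j = P_j L(alpha_j) = 0. Since L(z)^t* = (z^* )^2 L(1/z^* ),
   the behaviour of L^-1 at infinity is read off at 0: if P_0 and
   R are its first two coefficients at 0 (P_0 = 0 when 0 is not a pole), then
   P_0^t* B = 0 and P_0^t* A + R^t* B = I. Applied to the coefficient recurrence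
   of L L^-1 = I at infinity, these identities kill every Q_k and give
   sum_j P_j = P_0^t*, hence L^-1 = sum_j P_j / (z - alpha_j). *)
Require Import Defs.
From HB Require Import structures.
From mathcomp Require Import all_boot all_order all_algebra.
From mathcomp Require Import all_classical all_reals all_analysis.
From mathcomp Require Import ring.

Set Implicit Arguments.
Unset Strict Implicit.
Unset Printing Implicit Defensive.

Import Order.TTheory GRing.Theory Num.Theory.
Import numFieldNormedType.Exports.
Local Open Scope classical_set_scope.
Local Open Scope ring_scope.
Local Open Scope sesquilinear_scope.

(** * Polynomial identities checked off a finite set of points *)

Lemma poly_eq0_generic (K : numDomainType) (q e : {poly K}) :
  e != 0 -> (forall z, e.[z] != 0 -> q.[z] = 0) -> q = 0.
Proof.
move=> e0 qe0; apply/eqP; have: q * e == 0.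
  apply: contraT => qe_neq0.
  (* [q * e] vanishes everywhere, in particular at the naturals below its size, which are distinct
     in characteristic 0 and too many for its degree. *)
  have := max_poly_roots (rs := [seq i%:R | i <- iota 0 (size (q * e))]) qe_neq0.
  rewrite size_map size_iota ltnn; apply.
    apply/allP => x _; rewrite rootE hornerM.
    by have [->|/qe0->] := eqVneq e.[x] 0; rewrite ?mulr0 ?mul0r.
  rewrite map_inj_uniq ?iota_uniq// => i j /eqP.
  by rewrite eqr_nat => /eqP.
by rewrite mulf_eq0 (negPf e0) orbF.
Qed.

Lemma mxpoly_eq_generic (K : numDomainType) m n (X Y : 'M[{poly K}]_(m, n))
    (e : {poly K}) : e != 0 ->
  (forall z, e.[z] != 0 -> map_mx (horner_eval z) X = map_mx (horner_eval z) Y) ->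
  X = Y.
Proof.
move=> e0 XY; apply/matrixP => i j; apply/subr0_eq.
apply: (poly_eq0_generic e0) => z /XY/matrixP/(_ i j).
by rewrite !mxE hornerD hornerN /horner_eval => ->; rewrite subrr.
Qed.

Lemma coef_mul_polyC_mx (K : comNzRingType) m n r (X : 'M[K]_(m, n))
    (Y : 'M[{poly K}]_(n, r)) k :
  map_mx (coefp k) (map_mx polyC X *m Y) = X *m map_mx (coefp k) Y.
Proof.
apply/matrixP => i j; rewrite !mxE /coefp coef_sum.
by apply: eq_bigr => l _; rewrite !mxE coefCM.
Qed.

Lemma horner_polyC_mx (K : comNzRingType) m n (X : 'M[K]_(m, n)) z :
  map_mx (horner_eval z) (map_mx polyC X) = X.
Proof. by apply/matrixP => i j; rewrite !mxE /horner_eval hornerC. Qed.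

(** * Multiplicity of the eigenvalue 0 and column eigenvectors *)

Lemma mup0_char_poly (F : fieldType) n (S : 'M[F]_n) :
  (n - \rank S <= mup 0 (char_poly S))%N.
Proof.
rewrite mup_geq ?monic_neq0 ?char_poly_monic// polyC0 subr0.
set r := \rank S; set U := col_ebase S; set W := row_ebase S.
have detU : (\det (map_mx polyC U)) \is a GRing.unit.
  by rewrite det_map_mx rmorph_unit// -unitmxE col_ebase_unit.
(* Conjugation by [U] turns [S = U *m pid_mx r *m W] into [pid_mx r *m Y], whose last [n - r] rows
   are zero. *)
pose Y := W *m U.
have -> : char_poly S = \det ('X%:M - map_mx polyC (pid_mx r *m Y)).
  apply: (mulIr detU); rewrite /char_poly /char_poly_mx -det_mulmx.
  rewrite [RHS]mulrC -det_mulmx mulmxBl mulmxBr scalar_mxC -!map_mxM.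
  by rewrite -{1}(mulmx_ebase S) !mulmxA.
clearbody Y.
(* Each zero row leaves a factor ['X] in the characteristic matrix; [d] collects these factors. *)
pose d := \row_(i < n) (if (i < r)%N then 1 else 'X : {poly F}).
pose Z := \matrix_(i, j) (if (i < r)%N then 'X *+ (i == j) - (Y i j)%:P
                          else (i == j)%:R).
have -> : 'X%:M - map_mx polyC (pid_mx r *m Y) = diag_mx d *m Z.
  apply/matrixP => i j; rewrite mul_diag_mx !mxE.
  have -> : \sum_k (pid_mx r : 'M[F]_n) i k * Y k j =
      (if (i < r)%N then Y i j else 0).
    rewrite (bigD1 i)//= big1 ?addr0 => [|k ki]; rewrite mxE ?eqxx/=.
      by case: ifP => _; rewrite ?mul1r ?mul0r.
    by rewrite eq_sym (inj_eq val_inj) (negPf ki) mul0r.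
  by case: ifP => _; rewrite ?mul1r ?polyC0 ?subr0 ?mulr_natr.
rewrite det_mulmx det_diag dvdp_mulr//.
rewrite (bigID (fun i : 'I_n => (i < r)%N))/= big1 ?mul1r => [|i ir];
  last by rewrite mxE ir.
rewrite (eq_bigr (fun=> 'X)) => [|i /negPf ir]; last by rewrite mxE ir.
rewrite prodr_const dvdp_exp2l// leq_subLR.
rewrite -[leqLHS](card_ord n) -(cardC (fun i : 'I_n => (i < r)%N)) leq_add//.
rewrite -sum1_card (eq_bigl (fun i : 'I_n => (i < r)%N))//.
by rewrite -(big_ord_widen _ (fun=> 1%N) (rank_leq_row S)) sum1_card card_ord.
Qed.

(** [eigenvalue] refers to row vectors; transposing preserves the determinant of [S - l%:M], hence
    the eigenvalues. *)
Lemma eigenvalue_col (F : fieldType) n (S : 'M[F]_n) l :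
  reflect (exists2 u : 'cV_n, S *m u = l *: u & u != 0) (eigenvalue S l).
Proof.
have detE : \det (S - l%:M) = \det (S^T - l%:M).
  by rewrite -det_tr linearB/= tr_scalar_mx.
have -> : eigenvalue S l = eigenvalue S^T l.
  by rewrite /eigenvalue /eigenspace !kermx_eq0 !row_free_unit !unitmxE detE.
apply: (iffP eigenvalueP) => -[u uS u0]; exists u^T; rewrite ?trmx_eq0//.
  by apply: trmx_inj; rewrite trmx_mul trmxK uS linearZ/= trmxK.
by rewrite -trmx_mul uS linearZ.
Qed.

Lemma dimkerE (K : numClosedFieldType) p (X : 'M[K]_p) : dimker X = (p - \rank X)%N.
Proof. by rewrite /dimker mxrank_ker mxrank_tr. Qed.

(** * Symmetry of the pencil under inversion in the unit circle *)

Section SimplePolePencil.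
Variables (K : numClosedFieldType) (p : nat).
Implicit Types (X Y : 'M[K]_p) (z : K).

Lemma pencil_conj X Y z : X = X ^t* -> z != 0 ->
  (pencil X Y z) ^t* = z^* ^+ 2 *: pencil X Y (z^*)^-1.
Proof.
move=> hX z0; have zc0 : z^* != 0 by rewrite conjC_eq0.
apply/matrixP => i j; rewrite {1}hX !mxE !rmorphD !rmorphM ?rmorphXn/= !conjCK.
by field.
Qed.

Lemma singular_at_conjV X Y z : X = X ^t* -> z != 0 ->
  singular_at X Y z -> singular_at X Y (z^*)^-1.
Proof.
move=> hX z0 /eqP; rewrite -conjC_eq0 -det_map_mx -det_tr map_trmx => /eqP.
rewrite pencil_conj// detZ => /eqP; rewrite mulf_eq0 !expf_eq0/= conjC_eq0.
by rewrite (negPf z0) !andbF => /eqP.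
Qed.

(** * Invertibility off the poles and annihilation by the residues *)

Variables (A B : 'M[K]_p) (N : nat) (alpha : 'I_N -> K) (P : 'I_N -> 'M[K]_p).
Variables (M : nat) (Q : 'I_M.+1 -> 'M[K]_p).
Hypothesis hdet : exists z, \det (pencil A B z) != 0.
Hypothesis halpha : injective alpha.
Hypothesis hdec : partial_fractions A B alpha P Q.

Local Notation cst := (map_mx polyC).
Local Notation ev z := (map_mx (horner_eval z)).
Let Qpoly : 'M[{poly K}]_p := \sum_(k < M.+1) 'X^k *: cst (Q k).
Let Lpoly : 'M[{poly K}]_p := 'X^2 *: cst B + 'X *: cst A + cst (B ^t*).
Let D z := \sum_(j < N) (z - alpha j)^-1 *: P j + \sum_(k < M.+1) z ^+ k *: Q k.

Lemma pencil_taylor z j :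
  pencil A B z = pencil A B (alpha j)
    + (z - alpha j) *: ((alpha j + z) *: B + A).
Proof. by apply/matrixP => i k; rewrite !mxE; ring. Qed.

Let evZ m n z q (X : 'M[{poly K}]_(m, n)) : ev z (q *: X) = q.[z] *: ev z X.
Proof. exact: map_mxZ. Qed.

Let ev_Qpoly z : ev z Qpoly = \sum_(k < M.+1) z ^+ k *: Q k.
Proof.
rewrite /Qpoly map_mx_sum; apply: eq_bigr => k _.
by rewrite evZ hornerXn horner_polyC_mx.
Qed.

Let ev_Lpoly z : ev z Lpoly = pencil A B z.
Proof.
rewrite /Lpoly !map_mxD !evZ hornerXn hornerX.
by rewrite !horner_polyC_mx.
Qed.

Let generic : {poly K} := \det Lpoly * \prod_j ('X - (alpha j)%:P).

Let generic_neq0 : generic != 0.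
Proof.
rewrite mulf_neq0//; last first.
  by apply/prodf_neq0 => j _; rewrite polyXsubC_eq0.
have [z dz] := hdet; apply: contraNneq dz => d0.
by rewrite -ev_Lpoly det_map_mx d0 rmorph0.
Qed.

Let genericP z : generic.[z] != 0 ->
  \det (pencil A B z) != 0 /\ forall j, z != alpha j.
Proof.
rewrite hornerM mulf_eq0 negb_or => /andP[dz az]; split.
  by rewrite -ev_Lpoly det_map_mx.
move: az; rewrite horner_prod => /prodf_neq0 az j.
by have := az j isT; rewrite hornerXsubC subr_eq0.
Qed.

Let generic_mulV z : generic.[z] != 0 ->
  pencil A B z *m D z = 1%:M /\ D z *m pencil A B z = 1%:M.
Proof.
move=> /genericP[dz az]; rewrite -[D z]hdec//.
by rewrite mulmxV ?mulVmx// unitmxE unitfE.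
Qed.

(** [Dpoly] is [D] multiplied by the common denominator [d]. Unlike [D], it has a meaningful value
    at each [alpha j]. *)
Let d : {poly K} := \prod_j ('X - (alpha j)%:P).
Let d_ j : {poly K} := \prod_(k | k != j) ('X - (alpha k)%:P).
Let Dpoly : 'M[{poly K}]_p := \sum_j d_ j *: cst (P j) + d *: Qpoly.

Let d_eq0 z : d.[z] = 0 -> exists j, z = alpha j.
Proof.
rewrite horner_prod => /eqP/prodf_eq0[j _].
by rewrite hornerXsubC subr_eq0 => /eqP->; exists j.
Qed.

Let d_root j : d.[alpha j] = 0.
Proof. by rewrite horner_prod (bigD1 j)//= hornerXsubC subrr mul0r. Qed.

Let d_root_neq j k : k != j -> (d_ k).[alpha j] = 0.
Proof.
move=> kj; rewrite horner_prod (bigD1 j) 1?eq_sym//=.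
by rewrite hornerXsubC subrr mul0r.
Qed.

Let d_root_eq j : (d_ j).[alpha j] != 0.
Proof.
rewrite horner_prod; apply/prodf_neq0 => k kj.
by rewrite hornerXsubC subr_eq0 (inj_eq halpha) eq_sym.
Qed.

Let ev_Dpoly z : ev z Dpoly =
  \sum_j (d_ j).[z] *: P j + d.[z] *: \sum_(k < M.+1) z ^+ k *: Q k.
Proof.
rewrite /Dpoly map_mxD map_mx_sum evZ ev_Qpoly; congr (_ + _).
by apply: eq_bigr => j _; rewrite evZ horner_polyC_mx.
Qed.

Let ev_Dpoly_D z : (forall j, z != alpha j) -> ev z Dpoly = d.[z] *: D z.
Proof.
move=> az; rewrite ev_Dpoly scalerDr; congr (_ + _); rewrite scaler_sumr.
apply: eq_bigr => j _; rewrite scalerA /d (bigD1 j)//= hornerM hornerXsubC.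
by rewrite mulrAC mulfV ?mul1r// subr_eq0.
Qed.

Let mul_Dpoly : Lpoly *m Dpoly = d%:M /\ Dpoly *m Lpoly = d%:M.
Proof.
split; apply: (mxpoly_eq_generic generic_neq0) => z gz;
  have [dz az] := genericP gz; have [LD DL] := generic_mulV gz;
  rewrite map_mxM ev_Lpoly ev_Dpoly_D//.
  by rewrite -scalemxAr LD scalemx1 map_scalar_mx.
by rewrite -scalemxAl DL scalemx1 map_scalar_mx.
Qed.

(** [hdec] assumes a nonzero determinant, but the polynomial identity [Lpoly *m Dpoly = d%:M] holds
    everywhere and can be divided by [d.[z]] off the [alpha j]. *)
Lemma pencil_unit z : (forall j, z != alpha j) ->
  pencil A B z *m D z = 1%:M /\ pencil A B z \in unitmx.
Proof.
move=> az; have dz : d.[z] != 0.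
  by apply/eqP => /d_eq0[j zj]; have := az j; rewrite zj eqxx.
have LD : pencil A B z *m D z = 1%:M.
  have /(congr1 (ev z)) := mul_Dpoly.1.
  rewrite map_mxM ev_Lpoly ev_Dpoly_D//.
  rewrite -scalemxAr map_scalar_mx -scalemx1 => /(scalerI dz).
  exact.
by split=> //; have [] := mulmx1_unit LD.
Qed.

(** At [alpha j], [d] vanishes and [Dpoly] reduces to a nonzero multiple of [P j]. *)
Lemma pencil_residue j :
  pencil A B (alpha j) *m P j = 0 /\ P j *m pencil A B (alpha j) = 0.
Proof.
have evD : ev (alpha j) Dpoly = (d_ j).[alpha j] *: P j.
  rewrite ev_Dpoly d_root scale0r addr0 (bigD1 j)//= big1 ?addr0// => k kj.
  by rewrite d_root_neq ?scale0r.
have [/(congr1 (ev (alpha j))) LD /(congr1 (ev (alpha j)))] := mul_Dpoly.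
move: LD; rewrite !map_mxM ev_Lpoly evD.
rewrite -scalemxAr -scalemxAl map_scalar_mx/= /horner_eval d_root.
rewrite -scalemx1 scale0r => /eqP + /eqP.
by rewrite !scaler_eq0 (negPf (d_root_eq j)) => /eqP + /eqP.
Qed.

Lemma pencil_pole j : P j != 0 -> singular_at A B (alpha j).
Proof.
move=> Pj; apply/eqP; apply: contraNT Pj => dj; apply/eqP.
have [LP _] := pencil_residue j.
by rewrite -[P j](@mulKmx _ _ _ (pencil A B (alpha j))) ?unitmxE ?unitfE// LP mulmx0.
Qed.

Lemma pencil_mul_residue z j :
  pencil A B z *m P j = (z - alpha j) *: (((alpha j + z) *: B + A) *m P j).
Proof.
by rewrite (pencil_taylor z j) mulmxDl (pencil_residue j).1 add0r -scalemxAl.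
Qed.

Lemma residue_mul_pencil z j :
  P j *m pencil A B z = (z - alpha j) *: (P j *m ((alpha j + z) *: B + A)).
Proof.
by rewrite (pencil_taylor z j) mulmxDr (pencil_residue j).2 add0r -scalemxAr.
Qed.

(** * Expansions of the inverse at infinity and at 0 *)

Let S0 := \sum_j P j.
Let S1 := \sum_j alpha j *: P j.
(* [S1], [S0] and [Q k] are the coefficients of [z ^- 2], [z ^- 1] and [z ^+ k]
   in the expansion of [pencil^-1] at infinity; [T] shifts the indices by 2. *)
Let Tpoly : 'M[{poly K}]_p := 'X^2 *: Qpoly + 'X *: cst S0 + cst S1.
Let T k : 'M[K]_p := map_mx (coefp k) Tpoly.

(** [Tpoly] differs from [z ^+ 2 *: D z] by the tail with terms
    [alpha j ^+ 2 / (z - alpha j) *: P j]. Multiplied by the pencil, this tail becomes a polynomial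
    of degree at most 1, because [pencil *m P j] is divisible by [z - alpha j]. *)
Let mul_Tpoly : Lpoly *m Tpoly = ('X^2)%:M
   - ('X *: cst (\sum_j alpha j ^+ 2 *: (B *m P j))
      + cst (\sum_j alpha j ^+ 2 *: ((alpha j *: B + A) *m P j))).
Proof.
apply: (mxpoly_eq_generic generic_neq0) => z gz.
have [dz az] := genericP gz; have [LD _] := generic_mulV gz.
rewrite map_mxM ev_Lpoly /Tpoly !map_mxD map_mxN map_mxD.
rewrite !evZ ev_Qpoly map_scalar_mx.
rewrite !horner_polyC_mx /horner_eval hornerX hornerXn.
have -> : z ^+ 2 *: (\sum_(k < M.+1) z ^+ k *: Q k) + z *: S0 + S1 =
    z ^+ 2 *: D z - \sum_j (alpha j ^+ 2 / (z - alpha j)) *: P j.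
  rewrite /D scalerDr [X in _ = X - _]addrC -!addrA; congr (_ + _).
  rewrite !scaler_sumr -sumrN -!big_split/=; apply: eq_bigr => j _.
  have zj : z - alpha j != 0 by rewrite subr_eq0.
  by rewrite !scalerA -scaleNr -!scalerDl; congr (_ *: _); field.
rewrite mulmxBr -scalemxAr LD scalemx1; congr (_ - _).
  by rewrite /= horner_evalE hornerXn.
rewrite mulmx_sumr scaler_sumr -big_split; apply: eq_bigr => j _ /=.
rewrite -scalemxAr pencil_mul_residue !scalerA divfK ?subr_eq0//.
rewrite mulmxDl mulmxDl -!scalemxAl !scalerDr !scalerA addrA [z * _]mulrC.
by rewrite -scalerDl -mulrDr [alpha j + z]addrC.
Qed.

(** Only degrees [k.+2] are compared, so the correction of degree at most 1 in [mul_Tpoly] drops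
    out. *)
Let coef_T k : B *m T k + A *m T k.+1 + B ^t* *m T k.+2 = (k == 0%N)%:R%:M.
Proof.
have := congr1 (map_mx (coefp k.+2)) mul_Tpoly.
rewrite /Lpoly !mulmxDl -!scalemxAl !map_mxD map_mxN !map_mxD => E.
transitivity (map_mx (coefp k.+2) ('X^2 *: (cst B *m Tpoly))
   + map_mx (coefp k.+2) ('X *: (cst A *m Tpoly))
   + map_mx (coefp k.+2) (cst (B ^t*) *m Tpoly)).
  rewrite -!coef_mul_polyC_mx; congr (_ + _ + _); apply/matrixP => i j;
  by rewrite !mxE/= /coefp ?coefXnM ?coefXM//= subn2.
rewrite E; apply/matrixP => i j.
rewrite !mxE/= /coefp coefMn coefXn coefXM !coefC/= addr0 subr0.
by rewrite !eqSS.
Qed.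

Let T_Q k : T k.+2 = map_mx (coefp k) Qpoly.
Proof.
apply/matrixP => i j.
by rewrite /T /Tpoly !mxE/= /coefp !coefD coefXnM coefXM !coefC/= !addr0 subn2.
Qed.

Let T_ge k : (M.+3 <= k)%N -> T k = 0.
Proof.
case: k => [|[|k]]// Mk; rewrite T_Q map_mx_sum big1// => i _.
apply/matrixP => a b; rewrite !mxE/= /coefp coefXnM coefC.
have ik : (i < k)%N by rewrite (leq_trans (ltn_ord i)).
by rewrite ltnNge ltnW//= subn_eq0 leqNgt ik.
Qed.

Let T0 : T 0 = S1.
Proof.
apply/matrixP => i j.
by rewrite /T /Tpoly !mxE/= /coefp !coefD coefXnM coefXM !coefC/= !add0r.
Qed.

Let T1 : T 1 = S0.
Proof.
apply/matrixP => i j.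
by rewrite /T /Tpoly !mxE/= /coefp !coefD coefXnM coefXM !coefC/= addr0 add0r.
Qed.

Let T2 : T 2 = Q ord0.
Proof.
rewrite T_Q map_mx_sum big_ord_recl big1 ?addr0 => [|k _];
  apply/matrixP => i j; rewrite !mxE/= /coefp coefXnM ?coefC//.
Qed.

(* The first two coefficients of [pencil^-1] at 0; the pole at 0, if any, does
   not contribute to [R0] because [0^-1 = 0]. *)
Let P0 := \sum_(j | alpha j == 0) P j.
Let R0 := Q ord0 - \sum_j (alpha j)^-1 *: P j.

Let pencil0 : pencil A B 0 = B ^t*.
Proof. by rewrite /pencil expr0n/= !scale0r !add0r. Qed.

Let mul_P0 : B ^t* *m P0 = 0.
Proof.
rewrite mulmx_sumr big1// => j /eqP aj.
by rewrite -pencil0 -aj (pencil_residue j).1.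
Qed.

Let mul_R0 : A *m P0 + B ^t* *m R0 = 1%:M.
Proof.
have := coef_T 0; rewrite T0 T1 T2 eqxx => <-.
rewrite mulmxBr addrA addrAC; congr (_ + _).
rewrite /P0 big_mkcond !mulmx_sumr -sumrN -!big_split; apply: eq_bigr => j _ /=.
have := (pencil_residue j).1; rewrite /pencil !mulmxDl -!scalemxAl -!scalemxAr.
case: eqVneq => [->|aj]; first by rewrite invr0 !scale0r subr0 add0r.
(* For [alpha j] nonzero, [pencil A B (alpha j) *m P j = 0] divided by [alpha j] trades the terms in
   [B] and [A] of [coef_T 0] for the term of [R0]. *)
move=> /(congr1 (fun Z => (alpha j)^-1 *: Z)); rewrite !scalerDr !scalerA scaler0.
rewrite mulVf// scale1r expr2 mulKf// => /eqP; rewrite addr_eq0 => /eqP ->.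
by rewrite mulmx0 add0r.
Qed.

(** * Vanishing of the polynomial part and sum rules for the residues *)

Hypothesis hA : A = A ^t*.

Let mul_P0C : P0 ^t* *m B = 0.
Proof.
by rewrite -[B]trmxCK -map_mxM -trmx_mul mul_P0 trmx0 map_mx0.
Qed.

Let mul_R0C : P0 ^t* *m A + R0 ^t* *m B = 1%:M.
Proof.
rewrite [in LHS]hA -[B in LHS]trmxCK -!map_mxM -!trmx_mul -map_mxD -linearD/=.
by rewrite mul_R0 trmx1 map_mx1.
Qed.

(* A polynomial part of [pencil^-1] would give at infinity a Jordan chain of
   length 2; by the symmetry [z -> 1 / z^*] it would be a chain at 0, which the
   simple pole excludes. *)
Let T_eq0 k : (2 <= k)%N -> T k = 0.
Proof.
(* Descending induction on [k] from [M.+3], where [T] vanishes for degree reasons; [n] bounds the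
   distance to it. *)
suff H n : forall k, (2 <= k)%N -> (M.+3 <= k + n)%N -> T k = 0.
  by move=> k2; apply: (H M.+3) => //; rewrite leq_addl.
elim: n => [|n IHn] {}k k2; first by rewrite addn0 => /T_ge.
rewrite addnS => Mk; have Tk1 : T k.+1 = 0 by apply: IHn; rewrite ?addSn// ltnW.
have Tk2 : T k.+2 = 0.
  by apply: IHn; rewrite ?addSn//; apply: leqW => //; apply: leqW.
case: k => [|[|k]]// in k2 Mk Tk1 Tk2 *.
have := coef_T k.+1; rewrite Tk1 mulmx0 addr0 [in RHS]/= raddf0 => /eqP.
have := coef_T k.+2; rewrite Tk1 Tk2 !mulmx0 !addr0 [in RHS]/= raddf0 => BT.
rewrite addrC addr_eq0 => /eqP AT.
rewrite -[LHS]mul1mx -mul_R0C mulmxDl -!mulmxA BT AT mulmxN !mulmxA mul_P0C.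
by rewrite mul0mx mulmx0 oppr0 addr0.
Qed.

Let T2_eq0 : T 2 = 0. Proof. exact: T_eq0. Qed.
Let T3_eq0 : T 3 = 0. Proof. exact: T_eq0. Qed.

(** The argument of [T_eq0] one index lower: [B *m T 1 = 0] still holds, but
    [A *m T 1 = 1%:M - B *m T 0], so [P0 ^t*] survives. *)
Lemma sum_residues : \sum_j P j = (\sum_(j | alpha j == 0) P j) ^t*.
Proof.
rewrite -/P0 -/S0 -T1.
have := coef_T 1; rewrite T2_eq0 T3_eq0 !mulmx0 !addr0 raddf0 => BT.
have := coef_T 0; rewrite T2_eq0 mulmx0 addr0 => /eqP.
rewrite addrC eq_sym -subr_eq => /eqP AT.
rewrite -[LHS]mul1mx -mul_R0C mulmxDl -!mulmxA BT -AT mulmx0 addr0.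
by rewrite mulmxBr mulmx1 mulmxA mul_P0C mul0mx subr0.
Qed.

Lemma sum_residues_mul : \sum_j P j *m B = 0.
Proof. by rewrite -mulmx_suml sum_residues. Qed.

Lemma mul_sum_residues : \sum_j B *m P j = 0.
Proof.
rewrite -mulmx_sumr -/S0 -T1.
by have := coef_T 1; rewrite T2_eq0 T3_eq0 !mulmx0 !addr0 raddf0.
Qed.

Lemma invmx_pencil z : (forall j, z != alpha j) ->
  invmx (pencil A B z) = \sum_j (z - alpha j)^-1 *: P j.
Proof.
move=> az; have [LD Lu] := pencil_unit az.
rewrite -[LHS]mulmx1 -LD mulKmx// /D -ev_Qpoly.
suff -> : Qpoly = 0 by rewrite map_mx0 addr0.
apply/matrixP => i j; apply/polyP => k.
by have /matrixP/(_ i j) := T_eq0 (isT : (2 <= k.+2)%N); rewrite T_Q !mxE/= /coefp coef0.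
Qed.

Lemma mul_moment_residues : \sum_j (alpha j *: B + A) *m P j = 1%:M.
Proof.
have := coef_T 0; rewrite T2_eq0 mulmx0 addr0 T0 T1 eqxx => <-.
rewrite !mulmx_sumr -big_split; apply: eq_bigr => j _ /=.
by rewrite mulmxDl -scalemxAl -scalemxAr.
Qed.

(** [coef_T] only concerns products with the pencil on the left. Here [pencil^-1 *m pencil = 1%:M]
    is expanded at a single generic [z], and [sum_residues_mul] removes the dependence on [z]. *)
Lemma moment_residues_mul : \sum_j P j *m (alpha j *: B + A) = 1%:M.
Proof.
have [z gz] : exists z, generic.[z] != 0.
  apply/not_existsP => g0; case/eqP: generic_neq0.
  apply: (poly_eq0_generic (oner_neq0 {poly K})) => z _.
  by apply/eqP; apply: contraT => /g0.
have [_ az] := genericP gz; have [_ Lu] := pencil_unit az.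
rewrite -(mulVmx Lu) invmx_pencil// mulmx_suml.
rewrite -[LHS]addr0 -[X in _ + X = _](scaler0 _ z) -[X in _ + _ *: X = _]sum_residues_mul.
rewrite scaler_sumr -big_split/=.
apply: eq_bigr => j _; rewrite -scalemxAl residue_mul_pencil scalerA mulVf ?subr_eq0//.
by rewrite scale1r scalemxAr -mulmxDr addrAC -scalerDl.
Qed.

(* [residue_j * pencil'(alpha_j) * residue_j = residue_j] *)
Lemma residue_deriv j : P j *m (2 * alpha j *: B + A) *m P j = P j.
Proof.
rewrite -[RHS]mulmx1 -mul_moment_residues.
rewrite -[X in _ = _ *m X]addr0 -[X in _ = _ *m (_ + X)](scaler0 _ (alpha j)).
rewrite -[X in _ = _ *m (_ + _ *: X)]mul_sum_residues.
rewrite scaler_sumr -big_split (bigD1 j)//= [RHS]mulmxDr mulmx_sumr big1 ?addr0.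
  rewrite scalemxAl -mulmxDl mulmxA; congr (_ *m _ *m _).
  by rewrite addrAC -scalerDl mulr_natl mulr2n.
(* Cross terms vanish: [P j *m pencil A B (alpha k) *m P k] is zero, and it equals the cross term
   times the nonzero scalar [alpha k - alpha j]. *)
move=> k kj; rewrite scalemxAl -mulmxDl addrAC -scalerDl.
have := residue_mul_pencil (alpha k) j => /(congr1 (mulmx^~ (P k))).
rewrite -mulmxA (pencil_residue k).1 mulmx0 -scalemxAl => /esym/eqP.
rewrite scaler_eq0 subr_eq0 (inj_eq halpha) (negPf kj)/= => /eqP.
by rewrite mulmxA [alpha k + _]addrC.
Qed.

(** * Residue matrices of the Fuchsian equation *)

Variables (mu : K) (C : 'M[K]_p).
Let S j := residue mu A B C (P j) (alpha j).

(** Replacing [z] by [alpha j] in the coefficient changes the [j]-th term by a multiple of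
    [P j *m B] independent of [z - alpha j]; these changes sum to 0 by [sum_residues_mul]. *)
Lemma invmx_pencil_mul z : (forall j, z != alpha j) ->
  invmx (pencil A B z) *m (- (mu * z) *: B - (mu / 2) *: A + C) =
  \sum_j (z - alpha j)^-1 *: S j.
Proof.
move=> az; rewrite invmx_pencil// mulmx_suml.
rewrite -[RHS]addr0 -[X in _ = _ + X](scaler0 _ (- mu)).
rewrite -[X in _ = _ + _ *: X]sum_residues_mul scaler_sumr -big_split.
apply: eq_bigr => j _ /=; have zj : z - alpha j != 0 by rewrite subr_eq0.
have -> : - (mu * z) *: B - (mu / 2) *: A + C =
    - (mu *: (alpha j *: B + 2^-1 *: A)) + C - (mu * (z - alpha j)) *: B.
  by apply/matrixP => i k; rewrite !mxE; ring.
rewrite -scalemxAl mulmxBr -scalemxAr scalerBr scalerA scaleNr.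
by congr (_ - _ *: _); field.
Qed.

(** [mu%:M] is expanded by [moment_residues_mul]. The sum over [alpha j == 0] treats both cases of
    [\det B] at once, being empty when 0 is not a pole. *)
Lemma sum_residue : - \sum_j S j =
  mu%:M - (\sum_(j | alpha j == 0) P j) ^t* *m ((mu / 2) *: A + C).
Proof.
rewrite -sum_residues mulmx_suml -scalemx1 -moment_residues_mul scaler_sumr.
rewrite -!sumrN -big_split; apply: eq_bigr => j _ /=.
rewrite scalemxAr -mulmxBr -mulmxN; congr (_ *m _).
by apply/matrixP => i k; rewrite !mxE; field.
Qed.

(** The part in [mu] of the residue is [- mu / 2] times the derivative of the pencil at [alpha j],
    so [residue_deriv] applies. *)
Lemma residue_mul_residue j : S j *m P j = P j *m C *m P j - (mu / 2) *: P j.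
Proof.
rewrite -{4}(residue_deriv j) scalemxAl scalemxAr -mulmxBl -mulmxBr.
congr (_ *m _ *m _); apply/matrixP => i k; rewrite !mxE.
by field.
Qed.

Lemma solves_pencil_odeP (U : set K) f : (forall z, U z -> forall j, z != alpha j) ->
  solves_pencil_ode mu A B C U f <-> solves_fuchsian alpha S U f.
Proof.
move=> UNa; split=> sol z Uz; have [df E] := sol z Uz;
  have az := UNa z Uz; have [_ Lu] := pencil_unit az; split=> //.
  by rewrite -invmx_pencil_mul// -mulmxA -E mulKmx.
by rewrite E -invmx_pencil_mul// -mulmxA mulKVmx.
Qed.

Lemma mxrank_residue j : (\rank (S j) <= dimker (pencil A B (alpha j)))%N.
Proof.
rewrite dimkerE (leq_trans (mxrankM_maxl _ _))// leq_subRL ?rank_leq_row//.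
exact: mulmx0_rank_max (pencil_residue j).1.
Qed.

Lemma residue_im j u : im_mx (P j) u -> S j *m u = P j *m C *m u - (mu / 2) *: u.
Proof.
by move=> [v _ <-]; rewrite mulmxA residue_mul_residue mulmxBl -scalemxAl -!mulmxA.
Qed.

Lemma singular_at_pole z : singular_at A B z -> exists j, z = alpha j.
Proof.
move=> Lz; apply/not_existsP => az.
have [_] := pencil_unit (fun j => introN eqP (az j)).
by rewrite unitmxE Lz unitr0.
Qed.

Lemma singular_at0 : singular_at A B 0 <-> \det B = 0.
Proof.
rewrite /singular_at pencil0 det_map_mx det_tr/=.
by split=> [/eqP|->]; rewrite ?conjC0// conjC_eq0 => /eqP.
Qed.

(** An eigenvector for a nonzero eigenvalue lies in the image of [S j], hence in that of [P j],
    where [residue_im] compares the two matrices. *)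
Lemma residue_eigenvalue j l : l != 0 -> eigenvalue (S j) l ->
  eigenvalue (P j *m C) (l + mu / 2).
Proof.
move=> l0 /eigenvalue_col[u Su u0]; apply/eigenvalue_col; exists u => //.
have : im_mx (P j) u.
  exists ((- (mu *: (alpha j *: B + 2^-1 *: A)) + C) *m (l^-1 *: u)) => //.
  by rewrite mulmxA -scalemxAr Su scalerA mulVf ?scale1r.
by move=> /residue_im; rewrite Su scalerDl => ->; rewrite subrK.
Qed.

Lemma eigenvalue_residue j n : n != 0 -> eigenvalue (P j *m C) n ->
  eigenvalue (S j) (n - mu / 2).
Proof.
move=> n0 /eigenvalue_col[u PCu u0]; apply/eigenvalue_col; exists u => //.
rewrite residue_im ?PCu ?scalerBl//; exists (C *m (n^-1 *: u)) => //.
by rewrite mulmxA -scalemxAr PCu scalerA mulVf ?scale1r.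
Qed.

End SimplePolePencil.

(** * The five assertions over [R[i]] *)

Local Open Scope complex_scope.

Theorem theorem4p4 (R : realType) (p : nat) (hp : (1 <= p)%N)
  (mu : R) (hmu : 0 < mu) (A B C : 'M[R[i]]_p)
  (hA : A = A ^t*) (hC : C = C ^t*)
  (hdet : exists z : R[i], \det (pencil A B z) != 0)
  (hpoles : simple_poles A B)
  (N : nat) (alpha : 'I_N -> R[i]) (P : 'I_N -> 'M[R[i]]_p)
  (M : nat) (Q : 'I_M.+1 -> 'M[R[i]]_p)
  (halpha : injective alpha) (hP : forall j, P j != 0)
  (hdec : partial_fractions A B alpha P Q) :
  let S := fun j => residue mu%:C A B C (P j) (alpha j) in
  [/\ (* 1 *)
      forall (U : set R[i]) (f : R[i] -> 'cV[R[i]]_p),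
        (forall z, U z -> forall j, z != alpha j) ->
        (solves_pencil_ode mu%:C A B C U f <-> solves_fuchsian alpha S U f),
      (* 2 *)
      forall a : R[i], a != 0 -> singular_at A B a ->
        singular_at A B (a^*)^-1,
      (* 3 *)
      (\det B != 0 -> - \sum_(j < N) S j = (mu%:C)%:M) /\
      (\det B = 0 -> exists2 j0 : 'I_N, alpha j0 = 0 &
        - \sum_(j < N) S j =
          (mu%:C)%:M - (P j0) ^t* *m ((mu%:C / 2) *: A + C)),
      (* 4 *)
      forall j : 'I_N,
        [/\ (\rank (S j) <= dimker (pencil A B (alpha j)))%N,
            (p - dimker (pencil A B (alpha j)) <= dimker (S j))%N &
            (p - dimker (pencil A B (alpha j)) <= mup 0 (char_poly (S j)))%N] &
      (* 5 *)
      forall j : 'I_N,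
        [/\ forall u : 'cV[R[i]]_p, im_mx (P j) u ->
              S j *m u = P j *m C *m u - (mu%:C / 2) *: u,
            forall l : R[i], l != 0 -> eigenvalue (S j) l ->
              eigenvalue (P j *m C) (l + mu%:C / 2) &
            forall n : R[i], n != 0 -> eigenvalue (P j *m C) n ->
              eigenvalue (S j) (n - mu%:C / 2)]].
Proof.
move=> S; split.
- exact: (solves_pencil_odeP hdet halpha hdec hA).
- by move=> a a0 sa; exact: (singular_at_conjV hA a0 sa).
- have sumS := sum_residue hdet halpha hdec hA mu%:C C.
  have detB0 := singular_at0 A B.
  split=> detB.
    (* A pole at 0 would make the pencil singular there, against [\det B != 0]. *)
    rewrite [LHS]sumS big1 ?trmx0 ?map_mx0 ?mul0mx ?subr0// => j /eqP aj.
    by case/eqP: detB; apply/detB0; rewrite -aj; exact: (pencil_pole hdet halpha hdec).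
  (* Conversely a singular point is some [alpha j0], unique by injectivity of [alpha]. *)
  have /detB0 /(singular_at_pole hdet hdec)[j0 aj0] := detB.
  exists j0; first exact: esym aj0.
  have <- : \sum_(j | alpha j == 0) P j = P j0; last exact: sumS.
  by apply: big_pred1 => j; rewrite aj0 (inj_eq halpha).
- move=> j; have rS := mxrank_residue hdet halpha hdec mu%:C C j.
  have pS : (p - dimker (pencil A B (alpha j)) <= p - \rank (S j))%N.
    exact: leq_sub2l.
  split; [exact: rS | by rewrite (dimkerE (S j)) |].
  exact: leq_trans pS (mup0_char_poly _).
- move=> j; split.
  + exact: (residue_im hdet halpha hdec hA).
  + exact: (residue_eigenvalue hdet halpha hdec hA).
  + exact: (eigenvalue_residue hdet halpha hdec hA).
Qed.
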